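(* Let $A_1, \dots, A_n \in \mathbb{P}_m$, let $\omega = (w_1, \dots, w_n) \in \Delta_n$, and let $\Omega(\omega; A_1, \dots, A_n)$ be the Wasserstein mean. Then for the operator norm $\Vert \cdot \Vert$, $$\Vert \Omega(\omega; A_1, \dots, A_n) \Vert \leq \left( \sum_{j=1}^{n} w_j \Vert A_j \Vert^{1/2} \right)^{2}.$$
   Context: $\mathbb{P}_m$ is the set of all $m \times m$ complex positive definite Hermitian matrices. $\Delta_n$ is the set of positive probability vectors $\omega = (w_1, \dots, w_n) \in \mathbb{R}^n$, i.e. $w_j > 0$ for all $j$ and $\sum_{j=1}^n w_j = 1$. $\Vert \cdot \Vert$ is the operator norm on $m \times m$ matrices induced by the Euclidean norm on $\mathbb{C}^m$ (the spectral norm). The Wasserstein metric on $\mathbb{P}_m$ is $$d(A,B) = \left[ \operatorname{tr}\left( \frac{A+B}{2} \right) - \operatorname{tr} (A^{1/2} B A^{1/2})^{1/2} \right]^{1/2}.$$ The Wasserstein mean is the unique minimizer $$\Omega(\omega; A_1, \dots, A_n) = \underset{X \in \mathbb{P}_m}{\arg\min} \sum_{j=1}^n w_j d^2(X, A_j);$$ it is known to exist, to be unique, and to coincide with the unique solution $X \in \mathbb{P}_m$ of $X = \sum_{j=1}^n w_j (X^{1/2} A_j X^{1/2})^{1/2}$, equivalently of $I = \sum_{j=1}^n w_j (A_j \# X^{-1})$, where $A \# B = A^{1/2}(A^{-1/2} B A^{-1/2})^{1/2} A^{1/2}$. *)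

(* Defs.v *)
From HB Require Import structures.
From mathcomp Require Import all_boot all_order all_algebra.
From mathcomp Require Import spectral sesquilinear complex.
From mathcomp Require Import all_classical all_reals.

Set Implicit Arguments.
Unset Strict Implicit.
Unset Printing Implicit Defensive.

Import Order.TTheory GRing.Theory Num.Theory.
Local Open Scope ring_scope.
Local Open Scope classical_set_scope.
Local Open Scope complex_scope.
Local Open Scope sesquilinear_scope.

Definition posdefmx (R : realType) (m : nat) (A : 'M[R[i]]_m) : Prop :=
  A \is hermsymmx /\
  forall x : 'cV[R[i]]_m, x != 0 -> 0 < (x ^t* *m A *m x) 0 0.

Definition probvec (R : realType) (n : nat) (w : 'I_n -> R) : Prop :=
  (forall j, 0 < w j) /\ \sum_j w j = 1.

(* A^{1/2} by functional calculus: A = P^-1 D P with P unitary is sent to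
   P^-1 D^{1/2} P.  This is the positive square root when A is positive
   semidefinite; the value is meaningless when A is not normal. *)
Definition mxsqrt (R : realType) (m : nat) (A : 'M[R[i]]_m) : 'M[R[i]]_m :=
  invmx (spectralmx A) *m diag_mx (map_mx sqrtC (spectral_diag A))
    *m spectralmx A.

Definition l2norm (R : realType) (m : nat) (x : 'cV[R[i]]_m) : R :=
  Num.sqrt (\sum_i (complex.Re (x i 0) ^+ 2 + complex.Im (x i 0) ^+ 2)).

(* The supremum is over the closed unit ball rather than the unit sphere so
   that the set is nonempty also for m = 0. *)
Definition opnorm (R : realType) (m : nat) (A : 'M[R[i]]_m) : R :=
  sup [set l2norm (A *m x) | x in [set x : 'cV[R[i]]_m | l2norm x <= 1]].

(* For positive definite A and B the traces are real, so taking the real part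
   only changes the type. *)
Definition wdist (R : realType) (m : nat) (A B : 'M[R[i]]_m) : R :=
  Num.sqrt (complex.Re (\tr (2^-1 *: (A + B))
                        - \tr (mxsqrt (mxsqrt A *m B *m mxsqrt A)))).

Definition wcost (R : realType) (m n : nat) (w : 'I_n -> R)
    (A : 'I_n -> 'M[R[i]]_m) (X : 'M[R[i]]_m) : R :=
  \sum_j w j * wdist X (A j) ^+ 2.

(* X is the Wasserstein mean of the A_j with weights w_j, that is, X belongs to
   the argmin over the positive definite matrices; for positive definite A_j
   and w in Delta_n this argmin is a singleton. *)
Definition is_wasserstein_mean (R : realType) (m n : nat) (w : 'I_n -> R)
    (A : 'I_n -> 'M[R[i]]_m) (X : 'M[R[i]]_m) : Prop :=
  posdefmx X /\ forall Y : 'M[R[i]]_m, posdefmx Y -> wcost w A X <= wcost w A Y.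

(* Main.v *)
(* Let l be the largest eigenvalue of the mean X, with unit eigenvector v, and
   put K_j = (X^{1/2} A_j X^{1/2})^{1/2}. Compare X with Y = D X D, where
   D = 1 - s v v^* commutes with X^{1/2}. With W unitary such that
   Y^{1/2} = W D X^{1/2}, trace duality |tr (W M)| <= tr (M^* M)^{1/2} for
   M = K_j D W^* gives tr (Y^{1/2} A_j Y^{1/2})^{1/2} >= tr (D K_j)
   = tr K_j - s v^* K_j v. Minimality of X then yields, as s tends to 0,
   l <= sum_j w_j v^* K_j v <= sum_j w_j |K_j v|, and
   |K_j v|^2 = v^* X^{1/2} A_j X^{1/2} v = l v^* A_j v <= l |A_j|. *)
Require Import Defs.
From HB Require Import structures.
From mathcomp Require Import all_boot all_order all_algebra.
From mathcomp Require Import spectral sesquilinear complex.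
From mathcomp Require Import all_classical all_reals.
From mathcomp Require Import ring lra.
Import Order.TTheory GRing.Theory Num.Theory.
Local Open Scope ring_scope.
Local Open Scope complex_scope.
Local Open Scope sesquilinear_scope.

Set Implicit Arguments.
Unset Strict Implicit.
Unset Printing Implicit Defensive.

(** * Adjoints, Gram matrices and the spectral decomposition *)

Section Adjoint.
Context {C : numClosedFieldType}.

Lemma adjmxM m n p (A : 'M[C]_(m, n)) (B : 'M[C]_(n, p)) :
  (A *m B)^t* = B^t* *m A^t*.
Proof. by rewrite trmx_mul map_mxM. Qed.

Lemma adjmxE m n (A : 'M[C]_(m, n)) i j : (A^t*) i j = Num.conj (A j i).
Proof. by rewrite !mxE. Qed.

Lemma adjmx1 n : (1%:M : 'M[C]_n)^t* = 1%:M.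
Proof. by rewrite trmx1 map_mx1. Qed.

Lemma hermmxP n (A : 'M[C]_n) : reflect (A^t* = A) (A \is hermsymmx).
Proof.
by apply: (iffP (is_hermitianmxP _ _ _)); rewrite expr0 scale1r => /esym.
Qed.

Lemma gram_diagE m n (A : 'M[C]_(m, n)) i :
  (A *m A^t*) i i = \sum_j `|A i j| ^+ 2.
Proof. by rewrite mxE; apply: eq_bigr => j _; rewrite adjmxE normCK. Qed.

Lemma gram_diag_ge0 m n (A : 'M[C]_(m, n)) i : 0 <= (A *m A^t*) i i.
Proof. by rewrite gram_diagE sumr_ge0 // => j _; rewrite exprn_ge0. Qed.

Lemma dotmx_row m n (A B : 'M[C]_(m, n)) i :
  dotmx (row i A) (row i B) = (A *m B^t*) i i.
Proof. by rewrite dotmxE !mxE; apply: eq_bigr => j _; rewrite !mxE. Qed.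

(** Diagonal entries of A B^* are inner products of corresponding rows, so this is Cauchy-Schwarz
    row by row. *)
Lemma mulmx_adj_CauchySchwarz m n (A B : 'M[C]_(m, n)) i :
  `|(A *m B^t*) i i| <= sqrtC ((A *m A^t*) i i) * sqrtC ((B *m B^t*) i i).
Proof. by rewrite -!dotmx_row; apply: CauchySchwarz_sqrt. Qed.

Section Spectral.
Variables (n : nat) (A : 'M[C]_n).
Let P := spectralmx A.

Lemma spectral_adjKV : P *m P^t* = 1%:M.
Proof. exact/unitarymxP/spectral_unitarymx. Qed.

Lemma spectral_adjK : P^t* *m P = 1%:M.
Proof. by rewrite -invmx_unitary ?spectral_unitarymx // mulVmx // spectral_unit. Qed.

Hypothesis hA : A^t* = A.

Lemma spectral_decomp : A = P^t* *m diag_mx (spectral_diag A) *m P.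
Proof.
rewrite -invmx_unitary ?spectral_unitarymx //.
by apply/orthomx_spectralP/hermitian_normalmx/hermmxP.
Qed.

Lemma spectral_conj : P *m A *m P^t* = diag_mx (spectral_diag A).
Proof.
rewrite [in LHS]spectral_decomp !mulmxA spectral_adjKV mul1mx.
by rewrite -mulmxA spectral_adjKV mulmx1.
Qed.

Lemma spectral_diagE i : spectral_diag A 0 i = (P *m A *m P^t*) i i.
Proof. by rewrite spectral_conj mxE eqxx. Qed.

Lemma spectral_col_unit i : (col i (P^t*))^t* *m col i (P^t*) = 1%:M.
Proof.
apply/matrixP => j k; rewrite !ord1 [RHS]mxE eqxx {j k}.
transitivity ((P *m P^t*) i i); last by rewrite spectral_adjKV mxE eqxx.
by rewrite !mxE; apply: eq_bigr => k _; rewrite !mxE conjCK.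
Qed.

End Spectral.

Lemma diag_adj n (d : 'rV[C]_n) : (forall i, 0 <= d 0 i) ->
  (diag_mx d)^t* = diag_mx d.
Proof.
move=> d0; apply/matrixP => i j; rewrite adjmxE !mxE eq_sym.
by case: eqP => [->|_]; rewrite ?mulr0n ?conjC0 // mulr1n geC0_conj.
Qed.

End Adjoint.

Section Mean.
Context {R : realType}.
Local Notation C := R[i].

(** * The square root by functional calculus *)

Section SqrtA.
Variables (n : nat) (A : 'M[C]_n).
Hypotheses (hA : A^t* = A) (dA : forall i, 0 <= spectral_diag A 0 i).
Let P := spectralmx A.

Lemma mxsqrtE : mxsqrt A = P^t* *m diag_mx (map_mx sqrtC (spectral_diag A)) *m P.
Proof. by rewrite /mxsqrt invmx_unitary ?spectral_unitarymx. Qed.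

Lemma mxsqrt_adj : (mxsqrt A)^t* = mxsqrt A.
Proof.
rewrite mxsqrtE !adjmxM trmxCK diag_adj ?mulmxA // => i.
by rewrite mxE sqrtC_ge0.
Qed.

Lemma mxsqrtK : mxsqrt A *m mxsqrt A = A.
Proof.
rewrite mxsqrtE [RHS](spectral_decomp hA) -!mulmxA; congr (_ *m _).
rewrite (mulmxA P) spectral_adjKV mul1mx mulmxA; congr (_ *m _).
rewrite mulmx_diag; congr diag_mx; apply/rowP => i.
by rewrite !mxE -expr2 sqrtCK.
Qed.

Lemma mxtrace_mxsqrt : \tr (mxsqrt A) = \sum_i sqrtC (spectral_diag A 0 i).
Proof.
rewrite mxsqrtE mxtrace_mulC mulmxA spectral_adjKV mul1mx mxtrace_diag.
by apply: eq_bigr => i _; rewrite mxE.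
Qed.

Lemma spectral_eigen i : A *m col i (P^t*) = spectral_diag A 0 i *: col i (P^t*).
Proof.
rewrite colE mulmxA [in LHS](spectral_decomp hA) -(mulmxA _ P) spectral_adjKV.
rewrite mulmx1 -!mulmxA scalemxAr; congr (_ *m _).
by apply/colP => k; rewrite mul_diag_mx !mxE andbT; case: eqP => [->|]; rewrite ?mulr0.
Qed.

(** The root is diagonal in the same basis as A. At the top eigenvector of the mean this supplies
    the scalar r with r^2 = l. *)
Lemma mxsqrt_eigen i :
  mxsqrt A *m col i (P^t*) = sqrtC (spectral_diag A 0 i) *: col i (P^t*).
Proof.
rewrite colE mulmxA mxsqrtE -(mulmxA _ P) spectral_adjKV.
rewrite mulmx1 -!mulmxA scalemxAr; congr (_ *m _).
by apply/colP => k; rewrite mul_diag_mx !mxE andbT; case: eqP => [->|]; rewrite ?mulr0.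
Qed.

End SqrtA.

(* Trace duality: the trace norm of M is the trace of (M^* M)^{1/2}, and each
   diagonal entry in the eigenbasis of M^* M is bounded by Cauchy-Schwarz. *)
Lemma mxtrace_unitary_le n (U M : 'M[C]_n) : U *m U^t* = 1%:M ->
  `|\tr (U *m M)| <= \tr (mxsqrt (M^t* *m M)).
Proof.
move=> U1; set A := M^t* *m M; pose P := spectralmx A.
have hA : A^t* = A by rewrite adjmxM trmxCK.
(* Inserting P^* P = 1 brings in the rows of P U, which have norm 1, and those of P M^*, whose
   squared norms are the eigenvalues of A. *)
have -> : \tr (U *m M) = \tr ((P *m U) *m (P *m M^t*)^t*).
  by rewrite adjmxM trmxCK -mulmxA [RHS]mxtrace_mulC -!mulmxA spectral_adjK mulmx1.
rewrite mxtrace_mxsqrt; apply: le_trans (ler_norm_sum _ _ _) _.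
apply: ler_sum => i _; apply: le_trans (mulmx_adj_CauchySchwarz _ _ _) _.
rewrite adjmxM !mulmxA -(mulmxA P U) U1 mulmx1 spectral_adjKV mxE eqxx sqrtC1.
by rewrite mul1r adjmxM trmxCK !mulmxA spectral_diagE // !mulmxA.
Qed.

(** * Positive definite matrices and their square roots *)

Lemma posdef_adj n (A : 'M[C]_n) : posdefmx A -> A^t* = A.
Proof. by case=> /hermmxP. Qed.

Lemma posdef_unit n (A : 'M[C]_n) : posdefmx A -> A \in unitmx.
Proof.
(* Transposing turns the row kernel of [kermx] into a column kernel, on which the quadratic form of
   A vanishes. *)
move=> [hA pA]; rewrite -unitmx_tr -row_free_unit -kermx_eq0.
apply/rowV0P => u /sub_kermxP uA; apply/eqP; apply: contraT => u0.
have := pA u^T; rewrite -mulmxA -[A]trmxK -trmx_mul uA trmx0 mulmx0 mxE ltxx.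
by apply; apply: contraNneq u0 => /(congr1 trmx); rewrite trmxK trmx0 => ->.
Qed.

(** Each eigenvalue is the value of the quadratic form at a unit eigenvector. *)
Lemma posdef_spectral_gt0 n (A : 'M[C]_n) i : posdefmx A ->
  0 < spectral_diag A 0 i.
Proof.
move=> pA; have hA := posdef_adj pA.
pose v := col i ((spectralmx A)^t*).
have vv : v^t* *m v = 1%:M by apply: spectral_col_unit.
have v0 : v != 0.
  by apply: contra_eqN vv => /eqP ->; rewrite mulmx0 eq_sym oner_neq0.
have := pA.2 v v0.
by rewrite -mulmxA /v spectral_eigen // -scalemxAr -/v vv mxE mxE eqxx mulr1.
Qed.

Lemma posdef_congr n (A D : 'M[C]_n) : posdefmx A -> D \in unitmx ->
  posdefmx (D^t* *m A *m D).
Proof.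
move=> pA uD; split=> [|x x0].
  by apply/hermmxP; rewrite !adjmxM trmxCK (posdef_adj pA) mulmxA.
have := pA.2 (D *m x); rewrite adjmxM !mulmxA; apply.
by apply/eqP => /(canRL (mulKmx uD)); rewrite mulmx0; apply/eqP.
Qed.

Lemma mxsqrt_posdef n (A : 'M[C]_n) : posdefmx A ->
  [/\ (mxsqrt A)^t* = mxsqrt A, mxsqrt A *m mxsqrt A = A & mxsqrt A \in unitmx].
Proof.
move=> pA; have hA := posdef_adj pA.
have dA i : 0 <= spectral_diag A 0 i by apply/ltW/posdef_spectral_gt0.
have sA := mxsqrtK hA.
split=> //; first exact: mxsqrt_adj.
by have := posdef_unit pA; rewrite -{1}sA unitmx_mul => /andP[].
Qed.

Lemma fidelity_posdef n (X A : 'M[C]_n) : posdefmx X -> posdefmx A ->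
  posdefmx (mxsqrt X *m A *m mxsqrt X).
Proof.
move=> pX pA; have [hS _ uS] := mxsqrt_posdef pX.
by rewrite -{1}hS; apply: posdef_congr.
Qed.

Lemma invmx_adj n (N : 'M[C]_n) : N^t* = N -> N \in unitmx ->
  (invmx N)^t* = invmx N.
Proof.
move=> hN uN; rewrite -[LHS]mulmx1 -(mulmxV uN) mulmxA -{2}hN -adjmxM.
by rewrite mulmxV // adjmx1 mul1mx.
Qed.

(** This is the K_j of the overview; its trace is the fidelity term subtracted in [wdist]. *)
Definition fidmx n (X A : 'M[C]_n) := mxsqrt (mxsqrt X *m A *m mxsqrt X).

Lemma fidmxP n (X A : 'M[C]_n) : posdefmx X -> posdefmx A ->
  (fidmx X A)^t* = fidmx X A /\
  fidmx X A *m fidmx X A = mxsqrt X *m A *m mxsqrt X.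
Proof.
move=> pX pA; case: (mxsqrt_posdef (fidelity_posdef pX pA)) => hK KK _.
by split; [exact: hK | exact: KK].
Qed.

(** * Lower and upper bounds for the fidelity trace *)

Section FidelityBounds.
Variables (n : nat) (A S K : 'M[C]_n).
Hypotheses (hS : S^t* = S) (uS : S \in unitmx).
Hypotheses (hK : K^t* = K) (KK : K *m K = S *m A *m S).

(* D S and Q are both square roots of D S^2 D, hence differ by a unitary factor
   W, and trace duality applies to M = K D W^*, for which M^* M = Q A Q. *)
Lemma mxtrace_congr_le (D Q : 'M[C]_n) :
  D^t* = D -> D \in unitmx -> D *m S = S *m D ->
  Q^t* = Q -> Q *m Q = D *m (S *m S) *m D ->
  `|\tr (D *m K)| <= \tr (mxsqrt (Q *m A *m Q)).
Proof.
move=> hD uD DS hQ QQ.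
pose N := D *m S.
have hN : N^t* = N by rewrite adjmxM hD hS.
have uN : N \in unitmx by rewrite unitmx_mul uD.
have NN : N *m N = Q *m Q by rewrite {2}/N DS mulmxA -(mulmxA D) QQ.
pose W := Q *m invmx N.
have hW : W^t* = invmx N *m Q by rewrite adjmxM hQ invmx_adj.
have W1 : W^t* *m W = 1%:M.
  by rewrite hW /W mulmxA -(mulmxA _ Q Q) -NN mulmxA mulVmx // mul1mx mulmxV.
have WN : W *m N = Q by rewrite mulmxKV.
clearbody W; clear hW.
have := @mxtrace_unitary_le _ W (K *m D *m W^t*) (mulmx1C W1).
rewrite mxtrace_mulC -[_ *m W]mulmxA W1 mulmx1 mxtrace_mulC.
have -> // : (K *m D *m W^t*)^t* *m (K *m D *m W^t*) = Q *m A *m Q.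
rewrite !adjmxM trmxCK hD hK !mulmxA -(mulmxA _ K K) KK.
have -> : Q *m A *m Q = W *m N *m A *m (W *m N)^t* by rewrite WN hQ.
by rewrite adjmxM hN {2}/N DS /N !mulmxA.
Qed.

(* The nonnegative quantity is the squared Frobenius norm of S - S^-1 K. *)
Lemma mxtrace_AMGM : 0 <= \tr (S *m S) + \tr A - 2 * \tr K.
Proof.
pose Z := S - invmx S *m K.
have hZ : Z^t* = S - K *m invmx S.
  by rewrite /Z linearB /= map_mxB adjmxM hS hK invmx_adj.
have <- : \tr (Z *m Z^t*) = \tr (S *m S) + \tr A - 2 * \tr K.
  rewrite hZ mulmxBl !mulmxBr !raddfB /=.
  rewrite [\tr (S *m (K *m _))]mxtrace_mulC -mulmxA mulVmx // mulmx1.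
  rewrite [\tr (_ *m _ *m S)]mxtrace_mulC mulmxA mulmxV // mul1mx.
  rewrite !mulmxA -(mulmxA _ K K) KK !mulmxA mulVmx // mul1mx mulmxK //.
  by ring.
by rewrite /mxtrace sumr_ge0 // => i _; apply: gram_diag_ge0.
Qed.

End FidelityBounds.

(** * Real parts, the Euclidean norm and the operator norm *)

Lemma ge0_ReE (z : C) : 0 <= z -> z = (complex.Re z)%:C.
Proof. by move=> z0; rewrite -{1}(RRe_real (ger0_real z0)). Qed.

Lemma Re_le (z z' : C) : z <= z' -> complex.Re z <= complex.Re z'.
Proof. by rewrite lecE => /andP[]. Qed.

(** Carries complex inequalities such as trace duality over to the reals, through Re z <= |Re z| <=
    |z|. *)
Lemma norm_le_Re (z z' : C) : `|z| <= z' -> complex.Re z <= complex.Re z'.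
Proof.
move=> /Re_le; apply: le_trans; rewrite -lecR.
apply: le_trans (_ : `|z| <= _); last by rewrite -ge0_ReE.
by apply: le_trans (normc_ge_Re z); rewrite lecR ler_norm.
Qed.

Lemma ReB (z z' : C) : complex.Re (z - z') = complex.Re z - complex.Re z'.
Proof. by case: z z' => [a b] [c d]. Qed.

Lemma ReD (z z' : C) : complex.Re (z + z') = complex.Re z + complex.Re z'.
Proof. by case: z z' => [a b] [c d]. Qed.

Lemma ReZ (a : R) (z : C) : complex.Re (a%:C * z) = a * complex.Re z.
Proof. by case: z => [c d] /=; rewrite mul0r subr0. Qed.

Lemma l2norm_sqr n (x : 'cV[C]_n) : (l2norm x ^+ 2)%:C = (x^t* *m x) 0 0.
Proof.
rewrite /l2norm sqr_sqrtr; last by apply: sumr_ge0 => i _; rewrite addr_ge0 ?sqr_ge0.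
rewrite rmorph_sum mxE; apply: eq_bigr => i _.
by rewrite /= add_Re2_Im2 normCKC adjmxE.
Qed.

Lemma l2norm_ge0 n (x : 'cV[C]_n) : 0 <= l2norm x.
Proof. exact: sqrtr_ge0. Qed.

Lemma l2normE n (x : 'cV[C]_n) : (l2norm x)%:C = sqrtC ((x^t* *m x) 0 0).
Proof. by rewrite -l2norm_sqr rmorphXn /= sqrCK // ler0c l2norm_ge0. Qed.

Lemma l2norm_CauchySchwarz n (x y : 'cV[C]_n) :
  `|(x^t* *m y) 0 0| <= (l2norm x * l2norm y)%:C.
Proof.
rewrite rmorphM /= !l2normE.
by have := mulmx_adj_CauchySchwarz (x^t*) (y^t*) 0; rewrite !trmxCK.
Qed.

Lemma l2norm_diag_le n (d : 'rV[C]_n) (c : R) (x : 'cV[C]_n) :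
  (forall i, `|d 0 i| <= c%:C) -> 0 <= c ->
  l2norm (diag_mx d *m x) <= c * l2norm x.
Proof.
move=> dc c0; rewrite -(@ler_pXn2r _ 2) ?nnegrE ?mulr_ge0 ?l2norm_ge0 //.
rewrite -lecR exprMn [leRHS]rmorphM /= !l2norm_sqr.
rewrite mxE [X in _ <= _ * X]mxE mulr_sumr; apply: ler_sum => i _.
rewrite !adjmxE -!normCKC mul_diag_mx [(\matrix_(_, _) _) _ _]mxE normrM.
rewrite exprMn rmorphXn /=; apply: ler_wpM2r; first exact: exprn_ge0.
apply: lerXn2r (dc i); first by rewrite nnegrE.
by rewrite nnegrE ler0c.
Qed.

Lemma l2norm_isometry n (U : 'M[C]_n) (x : 'cV[C]_n) : U^t* *m U = 1%:M ->
  l2norm (U *m x) = l2norm x.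
Proof.
move=> U1; apply/complexI; rewrite !l2normE adjmxM -mulmxA (mulmxA _ U) U1.
by rewrite mul1mx.
Qed.

(** Unitary factors preserve the Euclidean norm, which leaves only the diagonal matrix of
    eigenvalues to bound. *)
Lemma l2norm_mul_le n (A : 'M[C]_n) (c : R) (x : 'cV[C]_n) : A^t* = A ->
  (forall i, `|spectral_diag A 0 i| <= c%:C) -> 0 <= c ->
  l2norm (A *m x) <= c * l2norm x.
Proof.
move=> hA dA c0; rewrite {1}(spectral_decomp hA) -!mulmxA.
rewrite l2norm_isometry ?trmxCK ?spectral_adjKV //.
apply: le_trans (l2norm_diag_le _ dA c0) _.
by rewrite l2norm_isometry // spectral_adjK.
Qed.

Lemma opnorm_le n (A : 'M[C]_n) (c : R) : 0 <= c ->
  (forall x, l2norm (A *m x) <= c * l2norm x) -> opnorm A <= c.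
Proof.
move=> c0 hc; apply: ge_sup.
  exists (l2norm (A *m 0)), 0 => //=.
  rewrite /l2norm big1 ?sqrtr0 ?ler01 // => i _.
  by rewrite mxE /= expr0n addr0.
by move=> _ [x /= x1 <-]; apply: le_trans (hc x) _; rewrite ler_piMr.
Qed.

Lemma le_opnorm n (A : 'M[C]_n) (x : 'cV[C]_n) : A^t* = A -> l2norm x <= 1 ->
  l2norm (A *m x) <= opnorm A.
Proof.
move=> hA x1; apply: ub_le_sup; last by exists x.
(* The sum of the absolute eigenvalues is a crude bound, enough for the supremum to be a genuine
   upper bound. *)
pose c := \sum_i complex.Re `|spectral_diag A 0 i|.
have nc i : `|spectral_diag A 0 i| = (complex.Re `|spectral_diag A 0 i|)%:C.
  exact/ge0_ReE.
have n0 i : 0 <= complex.Re `|spectral_diag A 0 i| by rewrite -ler0c -nc.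
have c0 : 0 <= c by apply: sumr_ge0 => i _.
exists c => _ [y /= y1 <-]; apply: le_trans (_ : c * l2norm y <= _); last first.
  by rewrite ler_piMr.
apply: l2norm_mul_le => // i; rewrite nc lecR /c (bigD1 i) //= lerDl.
by apply: sumr_ge0 => k _; apply: n0.
Qed.

Lemma opnorm_ge0 n (A : 'M[C]_n) : A^t* = A -> 0 <= opnorm A.
Proof.
move=> hA; apply: le_trans (l2norm_ge0 (A *m 0)) _; apply: le_opnorm => //.
rewrite /l2norm big1 ?sqrtr0 ?ler01 // => i _.
by rewrite mxE /= expr0n addr0.
Qed.

(** [mxtrace_AMGM] makes the radicand nonnegative, so squaring undoes [Num.sqrt], which is 0 on
    negative numbers. *)
Lemma wdist_sqr n (X A : 'M[C]_n) : posdefmx X -> posdefmx A ->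
  wdist X A ^+ 2 = complex.Re (2^-1 * (\tr X + \tr A) - \tr (fidmx X A)).
Proof.
move=> pX pA; rewrite /wdist -/(fidmx X A) mxtraceZ mxtraceD sqr_sqrtr //.
have [hS SS uS] := mxsqrt_posdef pX; have [hK KK] := fidmxP pX pA.
have := mxtrace_AMGM hS uS hK KK; rewrite SS.
move: (\tr (fidmx X A)) => f h.
have {h} : 0 <= 2^-1 * (\tr X + \tr A) - f.
  have -> : 2^-1 * (\tr X + \tr A) - f = 2^-1 * (\tr X + \tr A - 2 * f).
    by field.
  by apply: mulr_ge0 h; rewrite invr_ge0; exact: ler0n.
exact: Re_le.
Qed.

(** * Rank-one shrinking along an eigenvector *)

Section Perturbation.
Variables (n : nat) (X S : 'M[C]_n) (v : 'cV[C]_n) (l : R) (r : C).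
Hypotheses (hS : S^t* = S) (vv : v^t* *m v = 1%:M) (Xv : X *m v = l%:C *: v).
Hypotheses (r0 : 0 <= r) (r2 : r * r = l%:C) (Sv : S *m v = r *: v).

(** For a unit vector v this scales v by 1 - s and fixes its orthogonal complement. *)
Definition shrink (s : R) := 1%:M - s%:C *: (v *m v^t*).

Lemma rank1_idem : v *m v^t* *m (v *m v^t*) = v *m v^t*.
Proof. by rewrite mulmxA -(mulmxA v) vv mulmx1. Qed.

Lemma rank1_trace : \tr (v *m v^t*) = 1.
Proof. by rewrite mxtrace_mulC vv mxtrace1. Qed.

Lemma shrink_adj s : (shrink s)^t* = shrink s.
Proof.
rewrite /shrink linearB /= map_mxB adjmx1 linearZ /= map_mxZ adjmxM trmxCK.
by congr (_ - _ *: _); apply: conjc_real.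
Qed.

(** As v v^* is idempotent, the factors multiply as scalars do: (1 - s)(1 - t) = 1 - (s + t - s
    t). *)
Lemma shrink_mul s t : shrink s *m shrink t = shrink (s + t - s * t).
Proof.
rewrite /shrink mulmxBl !mulmxBr !mul1mx mulmx1 -scalemxAl -scalemxAr rank1_idem.
rewrite scalerA rmorphB rmorphD rmorphM /= scalerBl scalerDl.
by rewrite -!addrA; congr (_ + _); rewrite !opprD !opprK addrCA !addrA.
Qed.

Lemma shrink_unit s : s < 1 -> shrink s \in unitmx.
Proof.
(* The inverse is again of this form: t = - s / (1 - s) solves (1 - s)(1 - t) = 1. *)
move=> s1; have st : s + - s / (1 - s) - s * (- s / (1 - s)) = 0.
  by field; rewrite subr_eq0 gt_eqF.
have := shrink_mul s (- s / (1 - s)); rewrite st.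
rewrite {3}/shrink scale0r subr0 => /mulmx1_unit[uD _]; exact: uD.
Qed.

Lemma eigen_adj : v^t* *m S = r *: v^t*.
Proof. by rewrite -{1}hS -adjmxM Sv linearZ /= map_mxZ /= (geC0_conj r0). Qed.

(** Both v v^* S and S v v^* equal r v v^*, since S is Hermitian and r is real. *)
Lemma shrink_comm s : shrink s *m S = S *m shrink s.
Proof.
rewrite /shrink mulmxBl mulmxBr mul1mx mulmx1 -scalemxAl -scalemxAr.
by rewrite -mulmxA eigen_adj mulmxA Sv -scalemxAl -scalemxAr.
Qed.

Lemma shrink_posdef s : posdefmx X -> s < 1 ->
  posdefmx (shrink s *m X *m shrink s).
Proof.
by move=> pX s1; rewrite -{1}shrink_adj; apply: posdef_congr pX (shrink_unit s1).
Qed.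

Lemma shrink_trace s :
  \tr (shrink s *m X *m shrink s) = \tr X + ((s ^+ 2 - s *+ 2) * l)%:C.
Proof.
rewrite mxtrace_mulC mulmxA shrink_mul mxtrace_mulC /shrink mulmxBr mulmx1.
rewrite -scalemxAr mulmxA Xv -scalemxAl raddfB /= !mxtraceZ rank1_trace mulr1.
by rewrite -rmorphM -rmorphN; congr (_ + _%:C); rewrite mulr2n; ring.
Qed.

(** For Hermitian K the form v^* K v is real, so the real part only changes the type. *)
Definition quadRe (K : 'M[C]_n) := complex.Re ((v^t* *m K *m v) 0 0).

Lemma shrink_mul_trace (K : 'M[C]_n) s :
  \tr (shrink s *m K) = \tr K - s%:C * (v^t* *m K *m v) 0 0.
Proof.
rewrite /shrink mulmxBl mul1mx -scalemxAl raddfB /= mxtraceZ.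
by rewrite -[v *m _ *m K]mulmxA [\tr (v *m _)]mxtrace_mulC trace_mx11.
Qed.

Lemma l2norm_eq1 : l2norm v = 1.
Proof. by apply/complexI; rewrite l2normE vv mxE eqxx sqrtC1. Qed.

Lemma eig_ge0 : 0 <= l.
Proof. by rewrite -ler0c -r2 mulr_ge0. Qed.

Lemma quadRe_le_norm (B : 'M[C]_n) : quadRe B <= l2norm (B *m v).
Proof.
have -> : l2norm (B *m v) = complex.Re (l2norm (B *m v))%:C by [].
apply: norm_le_Re; rewrite -mulmxA.
by have := l2norm_CauchySchwarz v (B *m v); rewrite l2norm_eq1 mul1r.
Qed.

(** Cauchy-Schwarz bounds the form by |K v|, and S v = r v with r^2 = l turns |K v|^2 = v^* S A S v
    into l v^* A v. A second Cauchy-Schwarz bounds v^* A v by |A v|. *)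
Lemma quadRe_le (A K : 'M[C]_n) : A^t* = A -> K^t* = K ->
  K *m K = S *m A *m S -> quadRe K <= Num.sqrt l * Num.sqrt (opnorm A).
Proof.
move=> hA hK KK; apply: le_trans (quadRe_le_norm K) _.
have A0 := opnorm_ge0 hA; have l0 := eig_ge0.
rewrite -(@ler_pXn2r _ 2) ?nnegrE ?mulr_ge0 ?sqrtr_ge0 ?l2norm_ge0 //.
rewrite exprMn (sqr_sqrtr l0) (sqr_sqrtr A0).
have Kv : (K *m v)^t* *m (K *m v) = l%:C *: (v^t* *m A *m v).
  rewrite adjmxM hK mulmxA -(mulmxA _ K K) KK !mulmxA eigen_adj -(mulmxA _ S v) Sv.
  by rewrite -scalemxAr -!scalemxAl scalerA r2.
have -> : l2norm (K *m v) ^+ 2 = l * quadRe A.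
  by have := congr1 (@complex.Re R) (l2norm_sqr (K *m v)); rewrite Kv mxE ReZ.
apply: ler_wpM2l => //; apply: le_trans (quadRe_le_norm A) _.
by apply: le_opnorm; rewrite // l2norm_eq1.
Qed.

End Perturbation.

(** * Variation of the cost and first-order optimality *)

Lemma wdist_sqr_le n (X Y A : 'M[C]_n) (d k : R) :
  posdefmx X -> posdefmx Y -> posdefmx A -> \tr Y = \tr X + d%:C ->
  complex.Re (\tr (fidmx X A)) - k <= complex.Re (\tr (fidmx Y A)) ->
  wdist Y A ^+ 2 <= wdist X A ^+ 2 + d / 2 + k.
Proof.
move=> pX pY pA.
have := wdist_sqr pX pA; have := wdist_sqr pY pA.
generalize (wdist Y A ^+ 2) (wdist X A ^+ 2) (\tr (fidmx Y A)) (\tr (fidmx X A)).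
move=> a b f g -> -> -> h.
have -> : 2^-1 * (\tr X + d%:C + \tr A) = 2^-1 * (\tr X + \tr A) + (d / 2)%:C.
  rewrite [d / 2]mulrC rmorphM /= fmorphV rmorph_nat -mulrDr; congr (_ * _).
  by rewrite addrAC.
by rewrite !ReB ReD /=; lra.
Qed.

(** The trace of X contributes the term with s^2 - 2 s, while by trace duality the fidelity trace
    drops by at most s v^* K v. *)
Lemma wdist_shrink_le n (X A : 'M[C]_n) (v : 'cV[C]_n) (l s : R) (r : C) :
  posdefmx X -> posdefmx A -> v^t* *m v = 1%:M -> X *m v = l%:C *: v ->
  0 <= r -> mxsqrt X *m v = r *: v -> s < 1 ->
  wdist (shrink v s *m X *m shrink v s) A ^+ 2 <=
  wdist X A ^+ 2 + (s ^+ 2 - s *+ 2) * l / 2 + s * quadRe v (fidmx X A).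
Proof.
move=> pX pA vv Xv r0 Sv s1; have pY := shrink_posdef vv pX s1.
have [hS SS uS] := mxsqrt_posdef pX; have [hK KK] := fidmxP pX pA.
have [hQ QQ uQ] := mxsqrt_posdef pY.
apply: wdist_sqr_le pX pY pA (shrink_trace vv Xv s) _.
(* X is replaced by the square of its root, to match the form D S^2 D. *)
have QQ' := etrans QQ (congr1 (fun B => shrink v s *m B *m shrink v s) (esym SS)).
have := norm_le_Re (mxtrace_congr_le hS uS hK KK (shrink_adj v s)
  (shrink_unit vv s1) (shrink_comm hS r0 Sv s) hQ QQ').
apply: le_trans; rewrite shrink_mul_trace ReB ReZ; exact: lexx.
Qed.

Lemma opnorm_le_eigen n (X : 'M[C]_n) (c : R) : posdefmx X -> 0 <= c ->
  (forall j, complex.Re (spectral_diag X 0 j) <= c) -> opnorm X <= c.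
Proof.
move=> pX c0 dc; apply: (opnorm_le c0) => x.
apply: (l2norm_mul_le x (posdef_adj pX) _ c0) => j.
have d0 := ltW (posdef_spectral_gt0 j pX).
by rewrite (ger0_norm d0) (ge0_ReE d0) lecR.
Qed.

(** First-order optimality without derivatives: minimality is tested for each s in (0,1), and s is
    then taken small. *)
Lemma mean_eigen_le m n (w : 'I_n -> R) (A : 'I_n -> 'M[C]_m) (X : 'M[C]_m)
    (v : 'cV[C]_m) (l : R) (r : C) :
  (forall j, posdefmx (A j)) -> probvec w -> is_wasserstein_mean w A X ->
  v^t* *m v = 1%:M -> X *m v = l%:C *: v ->
  0 <= r -> mxsqrt X *m v = r *: v -> 0 < l ->
  l <= \sum_j w j * quadRe v (fidmx X (A j)).
Proof.
move=> pA [w0 w1] [pX minX] vv Xv r0 Sv l0.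
set T := \sum_j _.
(* Minimality gives 0 <= (s^2 - 2 s) l / 2 + s T, and dividing by s > 0 yields the claim. *)
have step s : 0 < s -> s < 1 -> l <= T + l * s / 2.
  move=> s0 s1.
  have := minX _ (shrink_posdef vv pX s1).
  have : wcost w A (shrink v s *m X *m shrink v s) <=
      wcost w A X + (s ^+ 2 - s *+ 2) * l / 2 + s * T.
    (* The weights sum to 1, so the constant c can be moved under the weighted sum. *)
    have cE c : wcost w A X + c + s * T =
        \sum_j w j * (wdist X (A j) ^+ 2 + c + s * quadRe v (fidmx X (A j))).
      rewrite -[c in LHS]mul1r -w1 mulr_suml mulr_sumr -!big_split /=.
      by apply: eq_bigr => j _; rewrite !mulrDr [w j * (s * _)]mulrCA.
    rewrite cE.
    apply: ler_sum => j _; apply: ler_wpM2l; first exact: ltW (w0 j).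
    exact: wdist_shrink_le pX (pA j) vv Xv r0 Sv s1.
  generalize (wcost w A (shrink v s *m X *m shrink v s)) (wcost w A X).
  move=> a b ab ba.
  rewrite -(ler_pM2l s0); rewrite mulr2n in ab; nra.
apply/ler_addgt0Pr => e e0.
have le0 : 0 < l + e by apply: addr_gt0.
(* With s = e / (l + e) < 1 the excess l s / 2 is below e. *)
have s0 : 0 < e / (l + e) by apply: divr_gt0.
have s1 : e / (l + e) < 1 by rewrite ltr_pdivrMr // mul1r ltrDr.
apply: le_trans (step _ s0 s1) _; rewrite lerD2l.
have h : e / (l + e) * (l + e) = e by rewrite divfK // gt_eqF.
nra.
Qed.

End Mean.

(** * From the largest eigenvalue of the mean to its norm *)

Theorem proposition4p2 (R : realType) (m n : nat) (w : 'I_n -> R)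
    (A : 'I_n -> 'M[R[i]]_m) (Omega : 'M[R[i]]_m)
    (hA : forall j, posdefmx (A j)) (hw : probvec w)
    (hOmega : is_wasserstein_mean w A Omega) :
  opnorm Omega <= (\sum_j w j * Num.sqrt (opnorm (A j))) ^+ 2.
Proof.
have pO := hOmega.1.
(* For m = 0 there are no eigenvalues to bound; otherwise [i0] makes the index set nonempty, so a
   largest eigenvalue exists. *)
case: (pickP (fun _ : 'I_m => true)) => [i0 _|none]; last first.
  by apply: opnorm_le_eigen pO (sqr_ge0 _) _ => j; have := none j.
have [i _ imax] := @arg_maxP _ _ _ i0 xpredT
  (fun j => complex.Re (spectral_diag Omega 0 j)) isT.
have d0 := posdef_spectral_gt0 i pO.
have dE := ge0_ReE (ltW d0).
set l := complex.Re (spectral_diag Omega 0 i) in imax dE.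
have l0 : 0 < l by rewrite -ltcR -dE.
pose v := col i ((spectralmx Omega)^t*).
have vv : v^t* *m v = 1%:M := spectral_col_unit Omega i.
have Xv : Omega *m v = l%:C *: v by rewrite -dE; apply/spectral_eigen/posdef_adj.
pose r := sqrtC (spectral_diag Omega 0 i).
have r0 : 0 <= r by rewrite sqrtC_ge0 ltW.
have r2 : r * r = l%:C by rewrite -expr2 sqrtCK -dE.
have Sv : mxsqrt Omega *m v = r *: v := mxsqrt_eigen Omega i.
have [hS _ _] := mxsqrt_posdef pO.
apply: le_trans (opnorm_le_eigen pO (ltW l0) (fun j => imax j isT)) _.
have := mean_eigen_le hA hw hOmega vv Xv r0 Sv l0.
set B := \sum_j w j * Num.sqrt _.
move=> lT; have : l <= Num.sqrt l * B.
  apply: le_trans lT _; rewrite mulr_sumr; apply: ler_sum => j _.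
  rewrite mulrCA; apply: ler_wpM2l; first exact: ltW (hw.1 j).
  have [hK KK] := fidmxP pO (hA j).
  exact: (quadRe_le hS vv r0 r2 Sv (posdef_adj (hA j)) hK KK).
(* Cancelling the positive factor sqrt l from l <= sqrt l * B leaves sqrt l <= B, which is then
   squared. *)
rewrite -{1}(sqr_sqrtr (ltW l0)) expr2 ler_pM2l ?sqrtr_gt0 // => lB.
rewrite -(sqr_sqrtr (ltW l0)) ler_pXn2r ?nnegrE ?sqrtr_ge0 //.
exact: le_trans (sqrtr_ge0 _) lB.
Qed.
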